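(* Suppose the semigroup $T_t$ admits a $(1,\Phi_1)$-LSI. Let $b_1=\Phi_1^{-1}$ be a convex, strictly increasing inverse of $\Phi_1$, and assume that the differential equation $$\frac{d}{dt}\tilde\rho(t)=-b_1(\tilde\rho(t))$$ has a $C^1$-solution $\tilde\rho(t)$ on $[0,t_0)$ with $\tilde\rho(0)>0$. Then for any $n\ge1$ and any $f:\mathcal{X}^n\to\mathbb{R}_+$ (with $\mathbb{E}[f]>0$) satisfying $\frac1n\frac{\mathrm{Ent}(f)}{\mathbb{E}[f]}\le\tilde\rho(0)$ we have $$\mathrm{Ent}(T_t^{\otimes n}f)\le n\,\tilde\rho(t)\,\mathbb{E}[f]\qquad\text{for all }0\le t<t_0,$$ where $\mathbb{E}$ and $\mathrm{Ent}$ are with respect to $\pi^n$.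
   Context: Setting: $\mathcal{X}$ is a finite set and $(L_{x,y})_{x,y\in\mathcal{X}}$ is a real matrix with $L_{x,y}\ge 0$ for $x\ne y$ and $\sum_{y}L_{x,y}=0$ for all $x$. $T_t=e^{tL}$, $t\ge0$, is the associated stochastic semigroup, acting by $(Lf)(x)=\sum_y L_{x,y}f(y)$, and $\pi$ is a stationary probability measure of $T_t$. The Dirichlet form is $\mathcal{E}(f,g)=-\sum_{x,y}L_{x,y}f(y)g(x)\pi(x)=\mathbb{E}_\pi[(-Lf)g]$. For a probability measure $\mu$ and $g\ge0$ put $\mathrm{Ent}_\mu(g)=\mathbb{E}_\mu\left[g\ln\frac{g}{\mathbb{E}_\mu[g]}\right]$ (natural logarithm, $0\ln 0=0$). $\pi^n$ is the product measure on $\mathcal{X}^n$ and $T_t^{\otimes n}$ is the product semigroup acting on functions on $\mathcal{X}^n$. $(1,\Phi_1)$-LSI: let $\Phi_1:[0,\infty)\to[0,\infty)$ be concave, continuous, non-negative with $\Phi_1(0)=0$. The semigroup $T_t$ admits a $(1,\Phi_1)$-LSI if $$\frac{\mathrm{Ent}_\pi(f)}{\mathbb{E}_\pi[f]}\le\Phi_1\left(\frac{\mathcal{E}(f,\ln f)}{\mathbb{E}_\pi[f]}\right)\qquad\text{for all } f:\mathcal{X}\to(0,\infty).$$ *)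

(* Defs.v *)
From mathcomp Require Export all_boot all_order all_algebra.
From mathcomp Require Export all_classical all_reals all_analysis.
Export Order.TTheory GRing.Theory Num.Theory.
Export numFieldNormedType.Exports.

Set Implicit Arguments.
Unset Strict Implicit.
Unset Printing Implicit Defensive.

Global Open Scope classical_set_scope.
Global Open Scope ring_scope.

Definition is_prob (R : realType) (X : finType) (mu : X -> R) : Prop :=
  (forall x, 0 <= mu x) /\ \sum_(x : X) mu x = 1.

Definition expect (R : realType) (X : finType) (mu g : X -> R) : R :=
  \sum_(x : X) mu x * g x.

(* Since [ln 0 = 0] and [_ / 0 = 0], the convention [0 ln 0 = 0] holds and the
   entropy of a function with zero expectation is 0. *)
Definition Ent (R : realType) (X : finType) (mu g : X -> R) : R :=
  expect mu (fun x => g x * ln (g x / expect mu g)).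

Definition generator (R : realType) (X : finType) (L : X -> X -> R) : Prop :=
  (forall x y, x != y -> 0 <= L x y) /\ (forall x, \sum_(y : X) L x y = 0).

Definition mxexp (R : realType) (q : nat) (A : 'M[R]_q) : 'M[R]_q :=
  limn (series (fun k : nat => k`!%:R^-1 *: A ^+ k)).

Definition mx_of_kernel (R : realType) (X : finType) (K : X -> X -> R) :
    'M[R]_#|X| :=
  \matrix_(i, j) K (enum_val i) (enum_val j).

(* [semigroup L t x y] is the (x, y) entry of e^{tL}. *)
Definition semigroup (R : realType) (X : finType) (L : X -> X -> R) (t : R) :
    X -> X -> R :=
  fun x y => mxexp (t *: mx_of_kernel L) (enum_rank x) (enum_rank y).

Definition kact (R : realType) (X : finType) (K : X -> X -> R) (f : X -> R) :
    X -> R :=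
  fun x => \sum_(y : X) K x y * f y.

Definition stationary (R : realType) (X : finType) (L : X -> X -> R)
    (pi : X -> R) : Prop :=
  forall t : R, 0 <= t -> forall f : X -> R,
    expect pi (kact (semigroup L t) f) = expect pi f.

(* X^n is [{ffun 'I_n -> X}]. *)
Definition prod_measure (R : realType) (X : finType) (n : nat) (pi : X -> R) :
    {ffun 'I_n -> X} -> R :=
  fun x => \prod_(i < n) pi (x i).

Definition tensor_kernel (R : realType) (X : finType) (n : nat)
    (K : X -> X -> R) : {ffun 'I_n -> X} -> {ffun 'I_n -> X} -> R :=
  fun x y => \prod_(i < n) K (x i) (y i).

Definition dirichlet (R : realType) (X : finType) (L : X -> X -> R)
    (pi f g : X -> R) : R :=
  - \sum_(x : X) \sum_(y : X) L x y * f y * g x * pi x.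

(* Only the values of [Phi] on [0, +oo[ matter. *)
Definition LSI_function (R : realType) (Phi : R -> R) : Prop :=
  [/\ forall x, 0 <= x -> 0 <= Phi x,
      convex_function (`[0, +oo[%classic : set R^o) (fun x => - Phi x),
      {within `[0, +oo[%classic, continuous Phi} &
      Phi 0 = 0].

Definition LSI1 (R : realType) (X : finType) (L : X -> X -> R) (pi : X -> R)
    (Phi1 : R -> R) : Prop :=
  LSI_function Phi1 /\
  forall f : X -> R, (forall x, 0 < f x) ->
    Ent pi f / expect pi f <=
    Phi1 (dirichlet L pi f (fun x => ln (f x)) / expect pi f).

(* The inverse of a function defined on [0, +oo[ is a function on its range,
   which may be bounded. *)
Definition range_nneg (R : realType) (Phi : R -> R) : set R :=
  Phi @` `[0, +oo[%classic.

Definition convex_increasing_inverse (R : realType) (Phi b : R -> R) : Prop :=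
  [/\ {in `[0, +oo[%classic, cancel Phi b},
      {in range_nneg Phi, cancel b Phi},
      convex_function (range_nneg Phi : set R^o) b &
      {in range_nneg Phi &, {homo b : u v / u < v}}].

(* Derivative relative to [I], hence one-sided at an end point of [I]. *)
Definition has_derivative_in (R : realType) (I : set R) (r : R -> R)
    (t dr : R) : Prop :=
  (r s - r t) / (s - t) @[s --> within I t^'] --> dr.

(* [b] is the right-hand side of the equation and is only meaningful on [D], so
   a solution has to take its values in [D]. *)
Definition C1_solution (R : realType) (I D : set R) (b r : R -> R) : Prop :=
  [/\ forall t, I t -> D (r t),
      forall t, I t -> has_derivative_in I r t (- b (r t)) &
      {within I, continuous (fun t => - b (r t))}].

(* Main.v *)
Require Import Defs.
From mathcomp Require Import ring lra.

(** Why the theorem holds.  Write [u t] for the evolved function, [a] for its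
    expectation, which the evolution preserves, and [F t = Ent (u t) / (n a)]
    for the entropy per coordinate.  For positive [f],
    [F' = - D / (n a)], where [D] is the Dirichlet form of the product semigroup
    at [(u t, ln (u t))] ([is_derive_Ent_flow]).  The point is that the
    inequality [Ent / E <= Phi1 (D / E)] tensorizes in the normalized form
    [Ent / (n E) <= Phi1 (D / (n E))] ([LSI1_prod]): entropy is subadditive over
    the coordinates ([Ent_prod_le]), the one-dimensional inequality applies in
    each coordinate with the others held fixed, and Jensen's inequality for the
    concave [Phi1], with weights proportional to the conditional expectations
    of [f], recombines the pieces ([concave_perspective_sum]).  Inverting
    [Phi1] gives [F' <= - b1 F].

    The comparison with [rho' = - b1 rho] rests on [b1] being increasing: where
    [F > rho] the difference [F - rho] is nonincreasing, so it cannot become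
    positive ([nonpos_of_derive_where_pos], [le_C1_solution]).

    A nonnegative [f] is replaced by [f + e].  This does not increase the
    entropy ([Ent_shift_le]), so the initial condition survives, and the
    evolution commutes with adding a constant ([flow_shift]); [Ent_le_shift]
    lets [e] tend to 0 at the end.

    The facts needed about [e^{tL}] are its differential equation, obtained by
    differentiating the power series of each entry ([is_derive_mxexp]), and the
    nonnegativity of its entries, obtained by comparing it with
    [e^{-ct} e^{t(L+c)}] through uniqueness for linear systems
    ([mxexp_unique], [mxexp_Metzler_ge0]). *)

Set Implicit Arguments.
Unset Strict Implicit.
Unset Printing Implicit Defensive.

(** * Entropy on a finite probability space *)

(** The tangent inequality [ln r <= r - 1] at [r = q / p], multiplied by [p]. *)
Lemma mulr_ln_le (R : realType) (p q : R) :
  0 <= p -> 0 < q -> p * ln q <= p * ln p + (q - p).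
Proof.
rewrite le_eqVlt => /predU1P[<- q0|p0 q0]; first by rewrite !mul0r add0r subr0 ltW.
have : ln (q / p) <= q / p - 1.
  rewrite -{1}(addrNK 1 (q / p)) addrC le_ln1Dx//.
  by rewrite ltrBrDl subrr divr_gt0.
rewrite ln_div ?posrE// -(ler_pM2l p0) !mulrBr mulr1 mulrCA divff ?gt_eqF//.
by rewrite mulr1; lra.
Qed.

Lemma expectD (R : realType) (X : finType) (mu f g : X -> R) :
  expect mu (fun x => f x + g x) = expect mu f + expect mu g.
Proof. by rewrite -big_split; apply: eq_bigr => x _; rewrite mulrDr. Qed.

Lemma expectB (R : realType) (X : finType) (mu f g : X -> R) :
  expect mu (fun x => f x - g x) = expect mu f - expect mu g.
Proof. by rewrite -sumrB; apply: eq_bigr => x _; rewrite mulrBr. Qed.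

Lemma expectZr (R : realType) (X : finType) (mu f : X -> R) (c : R) :
  expect mu (fun x => f x * c) = expect mu f * c.
Proof. by rewrite /expect mulr_suml; apply: eq_bigr => x _; rewrite mulrA. Qed.

Lemma expect_cst (R : realType) (X : finType) (mu : X -> R) (c : R) :
  is_prob mu -> expect mu (fun=> c) = c.
Proof. by move=> [_ mu1]; rewrite /expect -mulr_suml mu1 mul1r. Qed.

Lemma ler_expect (R : realType) (X : finType) (mu f g : X -> R) :
  is_prob mu -> (forall x, f x <= g x) -> expect mu f <= expect mu g.
Proof. by move=> [mu0 _] fg; apply: ler_sum => x _; exact: ler_wpM2l. Qed.

Lemma eq_expect (R : realType) (X : finType) (mu f g : X -> R) :
  f =1 g -> expect mu f = expect mu g.
Proof. by move=> fg; apply: eq_bigr => x _; rewrite fg. Qed.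

Lemma expect_gt0 (R : realType) (X : finType) (mu f : X -> R) :
  is_prob mu -> (forall x, 0 < f x) -> 0 < expect mu f.
Proof.
move=> [mu0 mu1] f0.
have E0 x : 0 <= mu x * f x by rewrite mulr_ge0// ltW.
rewrite lt_neqAle sumr_ge0// andbT eq_sym; apply/negP => /eqP Ef0.
move: mu1; rewrite big1 => [/esym/eqP|x _]; first by rewrite oner_eq0.
have /eqP := psumr_eq0P (fun x _ => E0 x) Ef0 (i := x) isT.
by rewrite mulf_eq0 (gt_eqF (f0 x)) orbF => /eqP.
Qed.

(** [0 <= f] is enough because both sides vanish at the zeros of [f]. *)
Lemma EntE (R : realType) (X : finType) (mu f : X -> R) :
  (forall x, 0 <= f x) -> 0 < expect mu f ->
  Ent mu f = expect mu (fun x => f x * ln (f x)) - expect mu f * ln (expect mu f).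
Proof.
move=> f0 Ef0; rewrite -expectZr -expectB; apply: eq_expect => x.
have := f0 x; rewrite le_eqVlt => /predU1P[<-|fx0]; first by rewrite !mul0r subr0.
by rewrite ln_div ?posrE// mulrBr.
Qed.

(** The half of the Gibbs variational principle that makes entropy subadditive:
    by [mulr_ln_le] with [p = f] and [q = g E f / E g], where [p] and [q] have
    the same expectation. *)
Lemma Ent_duality (R : realType) (X : finType) (mu f g : X -> R) :
  is_prob mu -> (forall x, 0 < f x) -> (forall x, 0 < g x) ->
  expect mu (fun x => f x * ln (g x / expect mu g)) <= Ent mu f.
Proof.
move=> mup f0 g0; have Ef0 := expect_gt0 mup f0; have Eg0 := expect_gt0 mup g0.
rewrite EntE// => [|x]; last exact: ltW.
set a := expect mu f in Ef0 *; set b := expect mu g in Eg0 *.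
have -> : expect mu (fun x => f x * ln (g x / b)) =
    expect mu (fun x => f x * ln (g x * (a / b))) - a * ln a.
  have -> : a * ln a = expect mu (fun x => f x * ln a) by rewrite expectZr.
  rewrite -expectB; apply: eq_expect => x.
  by rewrite ln_div ?posrE// lnM ?posrE ?divr_gt0// ln_div ?posrE//; ring.
rewrite lerD2r.
have -> : expect mu (fun x => f x * ln (f x)) =
    expect mu (fun x => f x * ln (f x) + (g x * (a / b) - f x)).
  rewrite expectD expectB expectZr -/a -/b mulrC -mulrA mulVf ?gt_eqF//.
  by rewrite mulr1 subrr addr0.
apply: ler_expect => // x.
by apply: mulr_ln_le; [exact: ltW|rewrite !mulr_gt0 ?invr_gt0].
Qed.

Lemma Ent_ge0 (R : realType) (X : finType) (mu f : X -> R) :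
  is_prob mu -> (forall x, 0 < f x) -> 0 <= Ent mu f.
Proof.
move=> mup f0; apply: le_trans (Ent_duality mup f0 (fun=> ltr01)).
by rewrite expect_cst// divr1 ln1 expectZr mulr0.
Qed.

(** Entropy is convex and homogeneous, hence subadditive, and a constant has
    entropy 0. The proof is the pointwise log-sum inequality for the pair
    [(f, e)] against the pair [(a, e)], where [a = E f]. *)
Lemma Ent_shift_le (R : realType) (X : finType) (mu f : X -> R) (e : R) :
  is_prob mu -> (forall x, 0 <= f x) -> 0 < expect mu f -> 0 < e ->
  Ent mu (fun x => f x + e) <= Ent mu f.
Proof.
move=> mup f0 Ef0 e0.
have fe0 x : 0 < f x + e by rewrite ltr_wpDl.
rewrite /Ent expectD expect_cst//; set a := expect mu f in Ef0 *.
have ae0 : 0 < a + e by rewrite addr_gt0.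
apply: ler_expect => // x.
have hq : 0 < (f x + e) / (a + e) by rewrite divr_gt0.
(* The two tangent inequalities at [f] and [e] are taken with the same ratio
   [q = (f + e) / (a + e)], so that their error terms add up to 0 by [ab]. *)
have h2 := mulr_ln_le (ltW e0) (mulr_gt0 e0 hq).
have ab : (f x + e) / (a + e) * a + e * ((f x + e) / (a + e)) = f x + e.
  by field; rewrite gt_eqF.
move: hq h2 ab; set q := (f x + e) / (a + e) => hq h2 ab.
rewrite lnM ?posrE// in h2.
have := f0 x; rewrite le_eqVlt => /predU1P[fx0|fx0].
  by move: (mulr_gt0 hq Ef0) h2 ab; rewrite -fx0 !mul0r !add0r; clearbody q; lra.
have h1 := mulr_ln_le (ltW fx0) (mulr_gt0 hq Ef0).
rewrite lnM ?posrE// in h1.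
by rewrite ln_div ?posrE//; clearbody q; lra.
Qed.

(** A quantitative form of the continuity of entropy under [g -> g + e], valid
    where [g] has zeros: [v ln v] is superadditive on the nonnegative reals, and
    the tangent inequality bounds its increment at the expectation. *)
Lemma Ent_le_shift (R : realType) (X : finType) (mu g : X -> R) (e : R) :
  is_prob mu -> (forall x, 0 <= g x) -> 0 < expect mu g -> 0 < e ->
  Ent mu g <= Ent mu (fun x => g x + e) - e * ln e
              + e * (1 + ln (expect mu g + e)).
Proof.
move=> mup g0 Eg0 e0.
have ge0 x : 0 < g x + e by rewrite ltr_wpDl.
rewrite EntE// EntE ?expectD ?expect_cst ?addr_gt0//; last first.
  by move=> x; exact: ltW.
set a := expect mu g in Eg0 *.
have ae0 : 0 < a + e by rewrite addr_gt0.
have := mulr_ln_le (ltW Eg0) ae0.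
suff : expect mu (fun x => g x * ln (g x) + e * ln e) <=
    expect mu (fun x => (g x + e) * ln (g x + e)).
  by rewrite expectD expect_cst//; lra.
apply: ler_expect => // x; rewrite mulrDl lerD//.
  have := g0 x; rewrite le_eqVlt => /predU1P[<-|gx0]; first by rewrite !mul0r.
  by rewrite ler_pM2l// ler_ln ?posrE// lerDl ltW.
by rewrite ler_pM2l// ler_ln ?posrE// lerDr.
Qed.

(** * The matrix exponential *)

Lemma cvg_sumr (R : realType) (I : finType) (u : I -> R ^nat) (l : I -> R) :
  (forall i, u i @ \oo --> l i) ->
  (fun n => \sum_i u i n) @ \oo --> \sum_i l i.
Proof. by move=> ul; apply: cvg_big => // -[x y]; exact: cvgD cvg_fst cvg_snd. Qed.

Lemma is_derive_sumr (R : realType) (I : finType) (F : I -> R -> R)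
    (dF : I -> R) (t : R) :
  (forall i, is_derive t 1 (F i) (dF i)) ->
  is_derive t 1 (fun s => \sum_i F i s) (\sum_i dF i).
Proof.
move=> Fd; have -> : (fun s => \sum_i F i s) = \sum_i F i.
  by apply/funext => s; rewrite fct_sumE.
elim/big_ind2 : _ => [|f1 d1 f2 d2 h1 h2|i _]; last exact: Fd.
  exact: is_derive_cst.
exact: is_deriveD.
Qed.

Lemma is_derive_mulr (R : realType) (f g : R -> R) (df dg t : R) :
  is_derive t 1 f df -> is_derive t 1 g dg ->
  is_derive t 1 (fun s => f s * g s) (df * g t + f t * dg).
Proof.
move=> fd gd; change (is_derive t 1 (f * g) (df * g t + f t * dg)).
apply: (is_derive_eq (is_deriveM fd gd)).
by rewrite addrC [_ *: df]mulrC.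
Qed.

Lemma is_derive_mulrl (R : realType) (c : R) (f : R -> R) (df t : R) :
  is_derive t 1 f df -> is_derive t 1 (fun s => c * f s) (c * df).
Proof.
move=> fd; have := is_derive_mulr (is_derive_cst c t 1) fd.
by rewrite mul0r add0r.
Qed.

Definition mxabs (R : realType) (q : nat) (A : 'M[R]_q) : R :=
  \sum_i \sum_j `|A i j|.

Lemma mxabs_ge0 (R : realType) (q : nat) (A : 'M[R]_q) : 0 <= mxabs A.
Proof. by do 2! apply: sumr_ge0 => ? _. Qed.

Lemma le_mxabs (R : realType) (q : nat) (A : 'M[R]_q) i j : `|A i j| <= mxabs A.
Proof.
rewrite /mxabs (bigD1 i)//= (bigD1 j)//= -addrA lerDl addr_ge0//.
  exact: sumr_ge0.
by do 2! apply: sumr_ge0 => ? _.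
Qed.

Lemma mxabsM (R : realType) (q : nat) (A B : 'M[R]_q) :
  mxabs (A *m B) <= mxabs A * mxabs B.
Proof.
rewrite /mxabs mulr_suml; apply: ler_sum => i _.
apply: (@le_trans _ _ (\sum_j \sum_l `|A i l| * `|B l j|)).
  apply: ler_sum => j _; rewrite mxE (le_trans (ler_norm_sum _ _ _))//.
  by apply: ler_sum => l _; rewrite normrM.
rewrite exchange_big mulr_suml; apply: ler_sum => l _.
rewrite -mulr_sumr ler_wpM2l// [leRHS](bigD1 l)//= lerDl.
by do 2! apply: sumr_ge0 => ? _.
Qed.

(** Coefficients of the power series in [t] of an entry of [B e^{tA}]. The left
    factor [B] makes the family stable under formal differentiation, which turns
    [B] into [B A]; one convergence proof then serves for the series and for its
    first two derivatives. *)
Definition exp_coef (R : realType) (q : nat) (A B : 'M[R]_q) (i j : 'I_q)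
    (k : nat) : R :=
  k`!%:R^-1 * (B *m A ^+ k) i j.

Lemma pseries_diffs_exp_coef (R : realType) (q : nat) (A B : 'M[R]_q) i j :
  pseries_diffs (exp_coef A B i j) = exp_coef A (B *m A) i j.
Proof.
apply/funext => k; rewrite /pseries_diffs /exp_coef factS natrM invfM mulrA.
by rewrite mulrA mulfV// mul1r exprS mulmxA.
Qed.

(** The terms are dominated by those of the exponential series of
    [mxabs A * |t|], because [mxabs] is submultiplicative. *)
Lemma cvg_exp_coef (R : realType) (q : nat) (A B : 'M[R]_q) i j (t : R) :
  cvgn (pseries (exp_coef A B i j) t).
Proof.
apply: normed_cvg.
apply: (series_le_cvg (v_ := fun k => mxabs B * exp_coeff (mxabs A * `|t|) k)).
- by move=> k; rewrite normr_ge0.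
- by move=> k; rewrite mulr_ge0 ?mxabs_ge0 ?exp_coeff_ge0// mulr_ge0 ?mxabs_ge0.
- move=> k; rewrite /exp_coef /exp_coeff/= !normrM normfV normrX.
  rewrite (ger0_norm (ler0n _ _)) exprMn.
  have -> : mxabs B * (mxabs A ^+ k * `|t| ^+ k / k`!%:R) =
    k`!%:R^-1 * (mxabs B * mxabs A ^+ k) * `|t| ^+ k by ring.
  rewrite ler_wpM2r ?exprn_ge0// ler_wpM2l ?invr_ge0//.
  apply: le_trans (le_mxabs _ _ _) _.
  elim: k => [|k IH]; first by rewrite !expr0 mulmx1 mulr1.
  rewrite !exprSr mulmxA mulrA (le_trans (mxabsM _ _))//.
  by rewrite ler_wpM2r ?mxabs_ge0.
exact/is_cvg_seriesZ/is_cvg_series_exp_coeff.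
Qed.

(** Convergence of matrices is uniform over the finitely many entries, so the
    limit defining [mxexp] may be computed entry by entry. *)
Lemma cvg_mxexp (R : realType) (q : nat) (A : 'M[R]_q) (t : R) i j :
  pseries (exp_coef A 1%:M i j) t @ \oo --> mxexp (t *: A) i j.
Proof.
pose S : 'M[R]_q := \matrix_(i, j) limn (pseries (exp_coef A 1%:M i j) t).
have serE n (k l : 'I_q) :
    series (fun k => k`!%:R^-1 *: (t *: A) ^+ k) n k l =
    pseries (exp_coef A 1%:M k l) t n.
  rewrite /series /pseries /series/= summxE; apply: eq_bigr => m _.
  rewrite !mxE /exp_coef mul1mx -[RHS]mulrA; congr (_ * _).
  elim: m k l => [|m IH] k l; first by rewrite !expr0 mulr1.
  rewrite !exprSr !mxE mulr_suml; apply: eq_bigr => p _.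
  by rewrite IH mxE; ring.
suff -> : mxexp (t *: A) = S by rewrite mxE; exact: cvg_exp_coef.
apply: cvg_lim => //; apply/cvgrPdist_le => e e0; near=> n.
rewrite /Num.Def.normr/= mx_normrE (bigmax_le _ (ltW e0))//= => -[k l] _ /=.
rewrite !mxE serE.
move: k l; near: n; apply: filter_forall => k; apply: filter_forall => l.
exact: (cvgrPdist_le _ _).1 (@cvg_exp_coef _ _ A 1%:M k l t) _ e0.
Unshelve. all: by end_near. Qed.

Lemma cvg_mulmx_mxexp (R : realType) (q : nat) (A B C : 'M[R]_q) (t : R) i j :
  (fun n => \sum_k \sum_l B i k * pseries (exp_coef A 1%:M k l) t n * C l j)
    @ \oo --> (B *m mxexp (t *: A) *m C) i j.
Proof.
rewrite -mulmxA mxE; apply: cvg_sumr => k; rewrite mxE mulr_sumr.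
apply: cvg_sumr => l; rewrite mulrA.
by apply: cvgM; [apply: cvgM; [exact: cvg_cst|exact: cvg_mxexp]|exact: cvg_cst].
Qed.

Lemma pseries_mulmx (R : realType) (q : nat) (A B C : 'M[R]_q) (t : R) i j n :
  \sum_k \sum_l B i k * pseries (exp_coef A 1%:M k l) t n * C l j =
  \sum_(0 <= m < n) m`!%:R^-1 * (B *m A ^+ m *m C) i j * t ^+ m.
Proof.
under eq_bigr => k _ do under eq_bigr => l _ do
  rewrite /pseries /series/= mulr_sumr mulr_suml.
under eq_bigr => k _ do rewrite exchange_big.
rewrite exchange_big/=; apply: eq_bigr => m _.
rewrite -mulmxA mxE mulr_sumr mulr_suml; apply: eq_bigr => k _.
rewrite mxE !mulr_sumr mulr_suml; apply: eq_bigr => l _.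
by rewrite /exp_coef mul1mx; ring.
Qed.

(** The partial sums of the two sides coincide. *)
Lemma mxexp_comm (R : realType) (q : nat) (A : 'M[R]_q) (t : R) :
  A *m mxexp (t *: A) = mxexp (t *: A) *m A.
Proof.
apply/matrixP => i j.
have := @cvg_mulmx_mxexp _ _ A A 1%:M t i j; rewrite mulmx1 => h1.
have := @cvg_mulmx_mxexp _ _ A 1%:M A t i j; rewrite mul1mx => h2.
apply: (cvg_unique _ h1); last apply: cvg_trans h2; first exact: Rhausdorff.
apply: near_eq_cvg; apply: nearW => n; rewrite !pseries_mulmx.
apply: eq_bigr => m _; rewrite mulmx1 mul1mx.
by rewrite (commrX m (erefl _ : GRing.comm A A) : A *m _ = _ *m A).
Qed.

Lemma is_derive_mxexp (R : realType) (q : nat) (A : 'M[R]_q) (t : R) i j :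
  is_derive t 1 (fun s => mxexp (s *: A) i j) ((A *m mxexp (t *: A)) i j).
Proof.
have -> : (fun s => mxexp (s *: A) i j) =
    (fun s => limn (pseries (exp_coef A 1%:M i j) s)).
  by apply/funext => s; apply/esym/cvg_lim => //; exact: cvg_mxexp.
have -> : (A *m mxexp (t *: A)) i j = limn (pseries (exp_coef A A i j) t).
  apply/esym/cvg_lim => //.
  have := @cvg_mulmx_mxexp _ _ A A 1%:M t i j; rewrite mulmx1.
  apply: cvg_trans; apply: near_eq_cvg; apply: nearW => n.
  by rewrite pseries_mulmx; apply: eq_bigr => m _; rewrite mulmx1.
have := @pseries_snd_diffs _ (exp_coef A 1%:M i j) (`|t| + 1) t.
rewrite !pseries_diffs_exp_coef mul1mx; apply; try exact: cvg_exp_coef.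
by rewrite [ltRHS]ger0_norm ?addr_ge0// ltrDl.
Qed.

Lemma mxexp0 (R : realType) (q : nat) (A : 'M[R]_q) : mxexp (0 *: A) = 1%:M.
Proof.
apply/matrixP => i j; apply: cvg_unique (cvg_mxexp (i := i) (j := j)) _ => //.
apply/cvgrPdist_le => e e0; near=> n.
have [m ->] : exists m, n = m.+1.
  by exists n.-1; rewrite prednK//; near: n; exact: nbhs_infty_gt.
rewrite /pseries /series/= big_nat_recl// expr0 mulr1 /exp_coef.
rewrite fact0 invr1 mul1r expr0 mulmx1 big1 ?addr0 ?subrr ?normr0 ?ltW// => k _.
by rewrite [0 ^+ _]expr0n mulr0.
Unshelve. all: by end_near. Qed.

Lemma is_derive_mulmx (R : realType) (q : nat) (M N : R -> 'M[R]_q)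
    (dM dN : 'M[R]_q) (t : R) :
  (forall i j, is_derive t 1 (fun s => M s i j) (dM i j)) ->
  (forall i j, is_derive t 1 (fun s => N s i j) (dN i j)) ->
  forall i j, is_derive t 1 (fun s => (M s *m N s) i j)
    ((dM *m N t + M t *m dN) i j).
Proof.
move=> Md Nd i j.
have -> : (fun s => (M s *m N s) i j) = (fun s => \sum_k M s i k * N s k j).
  by apply/funext => s; rewrite mxE.
rewrite !mxE -big_split/=; apply: is_derive_sumr => k.
exact: is_derive_mulr.
Qed.

(** Multiplied by [e^{-tA}], any solution of the linear system has derivative 0,
    so the product stays equal to the identity. Applied to [e^{tA}] itself this
    also shows that [e^{-tA}] is invertible. *)
Lemma mxexp_unique (R : realType) (q : nat) (A : 'M[R]_q) (S : R -> 'M[R]_q) :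
  S 0 = 1%:M ->
  (forall (t : R) i j, is_derive t 1 (fun s => S s i j) ((A *m S t) i j)) ->
  forall t, S t = mxexp (t *: A).
Proof.
pose inv t := mxexp (t *: - A).
have invS (T : R -> 'M[R]_q) : T 0 = 1%:M ->
    (forall (t : R) i j, is_derive t 1 (fun s => T s i j) ((A *m T t) i j)) ->
    forall t, inv t *m T t = 1%:M.
  move=> T0 Td t; apply/matrixP => i j.
  have -> : 1%:M i j = (inv 0 *m T 0) i j by rewrite /inv mxexp0 T0 mulmx1.
  apply: (@is_derive_0_is_cst _ (fun s => (inv s *m T s) i j)) => s.
  apply: is_derive_eq.
    apply: (is_derive_mulmx (M := inv)) (Td s) i j => k l.
    exact: is_derive_mxexp.
  rewrite -/(inv s) {1}/inv mxexp_comm -/(inv s) mulmxN mulNmx mulmxA addNr.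
  by rewrite mxE.
move=> S0 Sd t.
have inv_exp := mulmx1C (invS _ (mxexp0 A) (@is_derive_mxexp _ _ A) t).
by rewrite -[LHS]mul1mx -inv_exp -mulmxA invS// mulmx1.
Qed.

(** * The semigroup of a generator *)

Lemma mxexp_ge0 (R : realType) (q : nat) (B : 'M[R]_q) (t : R) i j :
  (forall k l, 0 <= B k l) -> 0 <= t -> 0 <= mxexp (t *: B) i j.
Proof.
move=> B0 t0.
have BX0 m k l : 0 <= (B ^+ m) k l.
  elim: m k l => [|m IH] k l; first by rewrite expr0 mxE ler0n.
  by rewrite exprSr mxE sumr_ge0// => p _; rewrite mulr_ge0.
have h := @cvg_mxexp R q B t i j; rewrite -(cvg_lim _ h)//.
apply: limr_ge; first exact: cvgP h.
apply: nearW => n; apply: sumr_ge0 => m _.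
by rewrite /= /exp_coef mul1mx !mulr_ge0 ?invr_ge0 ?exprn_ge0.
Qed.

(** [e^{tA} = e^{-ct} e^{t(A + c)}] by [mxexp_unique], and for large [c] the
    matrix [A + c] has nonnegative entries, hence so do all terms of its
    series. *)
Lemma mxexp_Metzler_ge0 (R : realType) (q : nat) (A : 'M[R]_q) (t : R) i j :
  (forall k l, k != l -> 0 <= A k l) -> 0 <= t -> 0 <= mxexp (t *: A) i j.
Proof.
move=> A0 t0; pose c := mxabs A; pose B := A + c%:M.
have B0 k l : 0 <= B k l.
  rewrite !mxE; have [->|kl] := eqVneq k l; last by rewrite addr0 A0.
  rewrite mulr1n -lerBlDr sub0r lerNl; move: (le_mxabs A l l).
  by rewrite -normrN; apply: le_trans; exact: ler_norm.
pose S s := expR (- c * s) *: mxexp (s *: B).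
suff <- : S t = mxexp (t *: A) by rewrite mxE mulr_ge0 ?expR_ge0 ?mxexp_ge0.
apply: (mxexp_unique (S := S)) => [|s k l].
  by rewrite /S mulr0 expR0 scale1r mxexp0.
have -> : (fun s => S s k l) = (fun s => expR (- c * s) * mxexp (s *: B) k l).
  by apply/funext => r; rewrite mxE.
have dexp : is_derive s 1 (fun s => expR (- c * s)) (expR (- c * s) * - c).
  apply: (@is_derive1_comp _ expR (fun s => - c * s)).
  by apply: is_derive_eq; rewrite [_ *: _]mulr1.
apply: is_derive_eq; first exact: is_derive_mulr dexp (is_derive_mxexp _ _ _ _).
rewrite /B mulmxDl mul_scalar_mx /S -scalemxAr -/B !mxE; ring.
Qed.

Lemma sum_enum_val (R : realType) (X : finType) (F : X -> R) :
  \sum_(i < #|X|) F (enum_val i) = \sum_x F x.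
Proof. by rewrite [RHS](reindex _ (onW_bij _ (enum_val_bij X))). Qed.

Lemma mx_of_kernelM (R : realType) (X : finType) (L : X -> X -> R)
    (M : 'M[R]_#|X|) (x y : X) :
  (mx_of_kernel L *m M) (enum_rank x) (enum_rank y) =
  \sum_z L x z * M (enum_rank z) (enum_rank y).
Proof.
rewrite mxE -[RHS]sum_enum_val; apply: eq_bigr => i _.
by rewrite mxE enum_rankK enum_valK.
Qed.

Lemma mx_of_kernelMr (R : realType) (X : finType) (L : X -> X -> R)
    (M : 'M[R]_#|X|) (x y : X) :
  (M *m mx_of_kernel L) (enum_rank x) (enum_rank y) =
  \sum_z M (enum_rank x) (enum_rank z) * L z y.
Proof.
rewrite mxE -[RHS]sum_enum_val; apply: eq_bigr => i _.
by rewrite mxE enum_rankK enum_valK.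
Qed.

Lemma is_derive_semigroup (R : realType) (X : finType) (L : X -> X -> R)
    (t : R) (x y : X) :
  is_derive t 1 (fun s => semigroup L s x y)
    (\sum_z L x z * semigroup L t z y).
Proof.
apply: is_derive_eq; first exact: is_derive_mxexp.
exact: mx_of_kernelM.
Qed.

Lemma is_derive_semigroupr (R : realType) (X : finType) (L : X -> X -> R)
    (t : R) (x y : X) :
  is_derive t 1 (fun s => semigroup L s x y)
    (\sum_z semigroup L t x z * L z y).
Proof.
apply: is_derive_eq; first exact: is_derive_mxexp.
by rewrite mxexp_comm mx_of_kernelMr.
Qed.

Lemma semigroup0 (R : realType) (X : finType) (L : X -> X -> R) (x y : X) :
  semigroup L 0 x y = (x == y)%:R.
Proof. by rewrite /semigroup mxexp0 mxE (inj_eq enum_rank_inj). Qed.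

Lemma semigroup_ge0 (R : realType) (X : finType) (L : X -> X -> R)
    (t : R) (x y : X) :
  generator L -> 0 <= t -> 0 <= semigroup L t x y.
Proof.
move=> [L0 _] t0; apply: mxexp_Metzler_ge0 => // k l kl.
by rewrite mxE L0// (inj_eq enum_val_inj).
Qed.

Lemma semigroup_sum1 (R : realType) (X : finType) (L : X -> X -> R)
    (t : R) (x : X) :
  generator L -> \sum_y semigroup L t x y = 1.
Proof.
move=> [_ L1]; have -> : 1 = \sum_y semigroup L 0 x y.
  rewrite (bigD1 x)//= semigroup0 eqxx big1 ?addr0// => y yx.
  by rewrite semigroup0 eq_sym (negbTE yx).
apply: (@is_derive_0_is_cst _ (fun s => \sum_y semigroup L s x y)) => s.
apply: is_derive_eq.
  by apply: is_derive_sumr => y; exact: is_derive_semigroupr.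
rewrite exchange_big big1// => z _.
by rewrite -mulr_sumr L1 mulr0.
Qed.

(** For [t >= 0] the row vector [pi e^{tL}] is constant, so its derivative
    [pi e^{tL} L = pi L] vanishes. The derivative is taken at [t = 1], where a
    neighbourhood lies in the half-line on which stationarity is known. *)
Lemma stationary_generator (R : realType) (X : finType) (L : X -> X -> R)
    (pi : X -> R) (y : X) :
  stationary L pi -> \sum_x pi x * L x y = 0.
Proof.
move=> st.
have piK t z : 0 <= t -> \sum_x pi x * semigroup L t x z = pi z.
  move=> t0; have := st t t0 (fun x => (x == z)%:R).
  rewrite /expect /kact [RHS](bigD1 z)//= eqxx mulr1.
  rewrite [X in _ = _ + X]big1; last first.
    by move=> x /negbTE ->; rewrite mulr0.
  rewrite addr0 => <-; apply: eq_bigr => x _; congr (_ * _).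
  rewrite (bigD1 z)//= eqxx mulr1 big1 ?addr0// => w /negbTE ->.
  by rewrite mulr0.
have d1 : is_derive (1 : R) 1 (fun s => \sum_x pi x * semigroup L s x y)
    (\sum_x pi x * L x y).
  apply: is_derive_eq.
    apply: is_derive_sumr => x; apply: is_derive_mulrl.
    exact: is_derive_semigroupr.
  under eq_bigr do rewrite mulr_sumr.
  rewrite exchange_big; apply: eq_bigr => z _.
  by rewrite -[in RHS](piK 1)// mulr_suml; apply: eq_bigr => x _; rewrite mulrA.
have d0 : is_derive (1 : R) 1 (fun s => \sum_x pi x * semigroup L s x y) 0.
  apply: near_eq_is_derive (is_derive_cst (pi y) _ _).
  near=> s; rewrite piK//; near: s; exact: lt_le_nbhsr.
by case: d1 => _ <-; case: d0.
Unshelve. all: by end_near. Qed.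

(** * Subadditivity of entropy on product spaces *)

(** Fixing all coordinates of [x] but the [i]-th, [z |-> f (upd x i z)] is the
    restriction of [f] to a line. *)
Definition upd (X : finType) (n : nat) (x : {ffun 'I_n -> X}) (i : 'I_n)
    (z : X) : {ffun 'I_n -> X} :=
  [ffun j => if j == i then z else x j].

Lemma upd_same (X : finType) (n : nat) (x : {ffun 'I_n -> X}) i z :
  upd x i z i = z.
Proof. by rewrite ffunE eqxx. Qed.

Lemma upd_id (X : finType) (n : nat) (x : {ffun 'I_n -> X}) i :
  upd x i (x i) = x.
Proof. by apply/ffunP => j; rewrite ffunE; case: eqVneq => // ->. Qed.

Lemma upd_upd (X : finType) (n : nat) (x : {ffun 'I_n -> X}) i y z :
  upd (upd x i y) i z = upd x i z.
Proof. by apply/ffunP => j; rewrite !ffunE; case: eqVneq. Qed.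

Lemma updC (X : finType) (n : nat) (x : {ffun 'I_n -> X}) i j y z :
  i != j -> upd (upd x i y) j z = upd (upd x j z) i y.
Proof.
move=> ij; apply/ffunP => k; rewrite !ffunE.
by case: (eqVneq k j) => // ->; rewrite eq_sym (negbTE ij).
Qed.

Lemma is_prob_prod_measure (R : realType) (X : finType) (n : nat)
    (pi : X -> R) :
  is_prob pi -> is_prob (@prod_measure R X n pi).
Proof.
move=> [pi0 pi1]; split=> [x|]; first exact: prodr_ge0.
by rewrite /prod_measure -(bigA_distr_bigA (fun _ z => pi z)) big1.
Qed.

Lemma prod_measure_upd (R : realType) (X : finType) (n : nat) (pi : X -> R)
    (x : {ffun 'I_n -> X}) i z :
  prod_measure pi (upd x i z) * pi (x i) = prod_measure pi x * pi z.
Proof.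
rewrite /prod_measure (bigD1 i)//= [in RHS](bigD1 i)//= upd_same.
rewrite (eq_bigr (fun j => pi (x j))) => [|j /negbTE ji]; first by ring.
by rewrite ffunE ji.
Qed.

(** Conditional expectation given all coordinates but [i], as a function of the
    whole point. *)
Definition avg (R : realType) (X : finType) (n : nat) (pi : X -> R) (i : 'I_n)
    (g : {ffun 'I_n -> X} -> R) : {ffun 'I_n -> X} -> R :=
  fun x => expect pi (fun z => g (upd x i z)).

(** Exchanging the resampled value [z] with the coordinate [x i] is an
    involution of pairs [(x, z)] which preserves the weight [pi^n(x) pi(z)]. *)
Lemma expect_avg (R : realType) (X : finType) (n : nat) (pi : X -> R)
    (i : 'I_n) (g : {ffun 'I_n -> X} -> R) :
  is_prob pi ->
  expect (prod_measure pi) (avg pi i g) = expect (prod_measure pi) g.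
Proof.
move=> [_ pi1]; rewrite /expect /avg /expect.
under eq_bigr do rewrite mulr_sumr.
rewrite pair_big/=.
pose s (p : {ffun 'I_n -> X} * X) := (upd p.1 i p.2, p.1 i).
have sK : involutive s.
  by move=> [x z]; rewrite /s/= upd_same upd_upd upd_id.
rewrite (reindex_inj (inv_inj sK))/=.
under eq_bigr do rewrite upd_upd upd_id mulrA prod_measure_upd.
rewrite -(pair_bigA _ (fun x z => prod_measure pi x * pi z * g x))/=.
apply: eq_bigr => x _.
by rewrite -mulr_suml -mulr_sumr pi1 mulr1.
Qed.

Lemma avg_upd (R : realType) (X : finType) (n : nat) (pi : X -> R) (i : 'I_n)
    (g : {ffun 'I_n -> X} -> R) x z :
  avg pi i g (upd x i z) = avg pi i g x.
Proof. by apply: eq_expect => w; rewrite upd_upd. Qed.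

Lemma avg_upd_neq (R : realType) (X : finType) (n : nat) (pi : X -> R)
    (i j : 'I_n) (g : {ffun 'I_n -> X} -> R) x z :
  (forall y w, g (upd y j w) = g y) -> avg pi i g (upd x j z) = avg pi i g x.
Proof.
move=> gj; have [->|ij] := eqVneq i j; first exact: avg_upd.
by apply: eq_expect => w; rewrite updC 1?eq_sym// gj.
Qed.

(** One point is turned into the other by resetting the coordinates one at a
    time. *)
Lemma eq_of_upd_invariant (R : realType) (X : finType) (n : nat)
    (h : {ffun 'I_n -> X} -> R) :
  (forall i x z, h (upd x i z) = h x) -> forall x y, h x = h y.
Proof.
move=> hinv x y.
pose p s := foldr (fun i (w : {ffun 'I_n -> X}) => upd w i (y i)) x s.
have pE s j : p s j = if j \in s then y j else x j.
  elim: s => //= i s IH; rewrite ffunE inE.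
  by case: eqVneq => [->//|_]; exact: IH.
have -> : y = p (enum 'I_n) by apply/ffunP => j; rewrite pE mem_enum.
by elim: (enum _) => //= i s IH; rewrite hinv.
Qed.

(** On each line in direction [i] this is [Ent_duality] for the restrictions of
    [f] and [g], averaged by [expect_avg]. *)
Lemma expect_ln_avg_le (R : realType) (X : finType) (n : nat) (pi : X -> R)
    (i : 'I_n) (f g : {ffun 'I_n -> X} -> R) :
  is_prob pi -> (forall x, 0 < f x) -> (forall x, 0 < g x) ->
  expect (prod_measure pi) (fun x => f x * ln (g x / avg pi i g x)) <=
  expect (prod_measure pi) (fun x => Ent pi (fun z => f (upd x i z))).
Proof.
move=> pip f0 g0; rewrite -(expect_avg i _ pip).
apply: ler_expect => [|x]; first exact: is_prob_prod_measure.
rewrite {1}/avg.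
under eq_expect do rewrite avg_upd.
exact: Ent_duality.
Qed.

(** Averaging [f] over the coordinates one after another leads from [f] to its
    expectation, and [ln (f / E f)] telescopes along the way. Each increment
    [ln (g / avg pi i g)] is controlled by [expect_ln_avg_le]; duality is what
    allows [g] to be a partial average rather than [f]. *)
Lemma Ent_prod_le (R : realType) (X : finType) (n : nat) (pi : X -> R)
    (f : {ffun 'I_n -> X} -> R) :
  is_prob pi -> (forall x, 0 < f x) ->
  Ent (prod_measure pi) f <=
  \sum_i expect (prod_measure pi) (fun x => Ent pi (fun z => f (upd x i z))).
Proof.
move=> pip f0; have mup := @is_prob_prod_measure R X n pi pip.
pose av s := foldr (avg pi) f s.
have av0 s x : 0 < av s x.
  elim: s x => //= i s IH x; exact: expect_gt0.
have Eav s : expect (prod_measure pi) (av s) = expect (prod_measure pi) f.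
  by elim: s => //= i s IH; rewrite expect_avg.
have avinv s i x z : i \in s -> av s (upd x i z) = av s x.
  elim: s x z => //= j s IH x z; rewrite inE => /predU1P[->|/IH sinv].
    exact: avg_upd.
  exact: avg_upd_neq.
have avE x : av (enum 'I_n) x = expect (prod_measure pi) f.
  rewrite -(Eav (enum 'I_n)) -[LHS](expect_cst _ mup); apply: eq_expect => y.
  by apply: eq_of_upd_invariant => i w z; rewrite avinv ?mem_enum.
have step s : expect (prod_measure pi) (fun x => f x * ln (f x)) -
    expect (prod_measure pi) (fun x => f x * ln (av s x)) <=
    \sum_(i <- s)
      expect (prod_measure pi) (fun x => Ent pi (fun z => f (upd x i z))).
  elim: s => [|i s IH]; first by rewrite big_nil subrr.
  rewrite big_cons; have := expect_ln_avg_le i pip f0 (av0 s).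
  under eq_expect do rewrite ln_div ?posrE ?(av0 (i :: s))// mulrBr.
  by rewrite expectB; lra.
have := step (enum 'I_n); rewrite big_enum/=; apply: le_trans.
rewrite EntE//; [|by move=> x; exact: ltW|exact: expect_gt0].
rewrite lerD2l lerN2 -expectZr le_eqVlt; apply/orP; left; apply/eqP.
by apply: eq_expect => x; rewrite avE.
Qed.

(** * Tensorization of the logarithmic Sobolev inequality *)

(** By the tangent inequality, [f(y) ln f(x) <= f(y) ln f(y) - f(y) + f(x)] with
    equality on the diagonal, where [L] may be negative. Summed against [pi L]
    the right-hand side vanishes by stationarity and because the rows of [L] sum
    to 0. *)
Lemma dirichlet_ln_ge0 (R : realType) (X : finType) (L : X -> X -> R)
    (pi f : X -> R) :
  generator L -> is_prob pi -> stationary L pi -> (forall x, 0 < f x) ->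
  0 <= dirichlet L pi f (fun x => ln (f x)).
Proof.
move=> [L0 L1] [pi0 _] st f0; rewrite /dirichlet oppr_ge0.
apply: (@le_trans _ _ (\sum_x \sum_y
    (pi x * L x y * (f y * ln (f y) - f y) + pi x * f x * L x y))).
  apply: ler_sum => x _; apply: ler_sum => y _.
  rewrite [leLHS](_ : _ = pi x * (L x y * (f y * ln (f x)))); last by ring.
  rewrite [leRHS](_ : _ = pi x * (L x y * (f y * ln (f y) + (f x - f y))));
    last by ring.
  rewrite ler_wpM2l//; have [->|xy] := eqVneq x y; first by rewrite subrr addr0.
  by rewrite ler_wpM2l ?L0// mulr_ln_le// ltW.
under eq_bigr do rewrite big_split/= -mulr_sumr L1 mulr0 addr0.
rewrite exchange_big big1// => y _.
by rewrite -mulr_suml stationary_generator// mul0r.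
Qed.

Lemma concave_nneg (R : realType) (Phi : R -> R) (t a b : R) :
  LSI_function Phi -> 0 <= t -> t <= 1 -> 0 <= a -> 0 <= b ->
  t * Phi a + (1 - t) * Phi b <= Phi (t * a + (1 - t) * b).
Proof.
move=> [_ cvx _ _] t0 t1 a0 b0.
have mem c : 0 <= c -> c \in (`[0, +oo[%classic : set R).
  by move=> c0; rewrite inE/= in_itv/= andbT.
have h : - Phi (t * a + (1 - t) * b) <= t * - Phi a + (1 - t) * - Phi b.
  exact: cvx (Itv01 t0 t1) a b (mem _ a0) (mem _ b0).
by lra.
Qed.

(** Jensen's inequality in the form: the perspective [(w, p) |-> w Phi(p / w)]
    of a concave function is superadditive. Leaving the weights unnormalized
    gives a statement that is stable under addition, hence provable by induction
    on the sum; the third condition on [w] and [p] handles weights equal to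
    0. *)
Lemma concave_perspective_sum (R : realType) (Phi : R -> R) (I : finType)
    (w p s : I -> R) :
  LSI_function Phi ->
  (forall i, [/\ 0 <= w i, 0 <= p i, w i = 0 -> p i = 0 &
                 s i <= w i * Phi (p i / w i)]) ->
  \sum_i s i <= (\sum_i w i) * Phi ((\sum_i p i) / \sum_i w i).
Proof.
move=> hPhi hi.
pose Q W P S := [/\ 0 <= W, 0 <= P, W = 0 -> P = 0 & S <= W * Phi (P / W)].
suff [] : Q (\sum_i w i) (\sum_i p i) (\sum_i s i) by [].
apply: (big_ind3 Q) => [|W1 P1 S1 W2 P2 S2|i _]; last exact: hi.
  by split=> //; rewrite mul0r.
move=> [W10 P10 WP1 S1le] [W20 P20 WP2 S2le].
have [W1z|W1n] := eqVneq W1 0.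
  move: S1le; rewrite (WP1 W1z) W1z !add0r mul0r => S1le; split=> //; lra.
have [W2z|W2n] := eqVneq W2 0.
  move: S2le; rewrite (WP2 W2z) W2z !addr0 mul0r => S2le; split=> //; lra.
have W1p : 0 < W1 by rewrite lt_neqAle eq_sym W1n.
have W2p : 0 < W2 by rewrite lt_neqAle eq_sym W2n.
have Wp : 0 < W1 + W2 by rewrite addr_gt0.
split; [exact: addr_ge0|exact: addr_ge0|by lra|].
have t1 : W1 / (W1 + W2) <= 1 by rewrite ler_pdivrMr// mul1r lerDl.
have := concave_nneg hPhi (divr_ge0 W10 (ltW Wp)) t1
  (divr_ge0 P10 W10) (divr_ge0 P20 W20).
rewrite (_ : _ * (P1 / W1) + _ = (P1 + P2) / (W1 + W2)); last first.
  by field; rewrite W1n W2n gt_eqF.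
move=> h; apply: le_trans (lerD S1le S2le) _.
apply: le_trans (ler_wpM2l (ltW Wp) h).
rewrite le_eqVlt; apply/orP; left; apply/eqP.
by field; rewrite gt_eqF.
Qed.

(** The generator acting on the [i]-th coordinate; the generator of the product
    semigroup is the sum of these over [i]. *)
Definition site_gen (R : realType) (X : finType) (n : nat) (L : X -> X -> R)
    (i : 'I_n) (g : {ffun 'I_n -> X} -> R) : {ffun 'I_n -> X} -> R :=
  fun x => \sum_z L (x i) z * g (upd x i z).

Definition site_dirichlet (R : realType) (X : finType) (n : nat)
    (L : X -> X -> R) (pi : X -> R) (f : {ffun 'I_n -> X} -> R) (i : 'I_n)
    (x : {ffun 'I_n -> X}) : R :=
  dirichlet L pi (fun z => f (upd x i z)) (fun z => ln (f (upd x i z))).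

(** The Dirichlet form of the product semigroup at [(f, ln f)]; the reason is
    [expect_site_dirichlet]. *)
Definition prod_dirichlet_ln (R : realType) (X : finType) (n : nat)
    (L : X -> X -> R) (pi : X -> R) (f : {ffun 'I_n -> X} -> R) : R :=
  \sum_i expect (prod_measure pi) (site_dirichlet L pi f i).

Lemma expect_site_dirichlet (R : realType) (X : finType) (n : nat)
    (L : X -> X -> R) (pi : X -> R) (f : {ffun 'I_n -> X} -> R) (i : 'I_n) :
  is_prob pi ->
  expect (prod_measure pi) (site_dirichlet L pi f i) =
  - expect (prod_measure pi) (fun x => site_gen L i f x * ln (f x)).
Proof.
move=> pip; rewrite -[X in - X](expect_avg i _ pip) /expect -sumrN.
apply: eq_bigr => x _; rewrite -mulrN; congr (_ * _).
rewrite /site_dirichlet /dirichlet /avg /expect; congr (- _).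
apply: eq_bigr => z _; rewrite /site_gen upd_same mulr_suml mulr_sumr.
by apply: eq_bigr => w _; rewrite upd_upd; ring.
Qed.

Lemma expect_site_gen (R : realType) (X : finType) (n : nat)
    (L : X -> X -> R) (pi : X -> R) (g : {ffun 'I_n -> X} -> R) (i : 'I_n) :
  is_prob pi -> stationary L pi ->
  expect (prod_measure pi) (site_gen L i g) = 0.
Proof.
move=> pip st; rewrite -(expect_avg i _ pip) /expect big1// => x _.
rewrite /avg /expect /site_gen.
under eq_bigr do rewrite upd_same mulr_sumr.
rewrite exchange_big big1 ?mulr0// => w _.
under eq_bigr do rewrite upd_upd mulrA.
by rewrite -mulr_suml stationary_generator// mul0r.
Qed.

(** The inequality keeps the same [Phi] in every dimension [n] once entropy and
    Dirichlet form are divided by [n]. The weights in Jensen's inequality,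
    indexed by a coordinate [i] and a point [x], are [pi^n(x) avg pi i f x], of
    total mass [n E f]. *)
Lemma LSI1_prod (R : realType) (X : finType) (n : nat) (L : X -> X -> R)
    (pi : X -> R) (Phi : R -> R) (f : {ffun 'I_n -> X} -> R) :
  generator L -> is_prob pi -> stationary L pi -> LSI1 L pi Phi ->
  (forall x, 0 < f x) ->
  Ent (prod_measure pi) f <= n%:R * expect (prod_measure pi) f *
    Phi (prod_dirichlet_ln L pi f / (n%:R * expect (prod_measure pi) f)).
Proof.
move=> hL pip st [hPhi lsi] f0; apply: le_trans (Ent_prod_le pip f0) _.
have mup := @is_prob_prod_measure R X n pi pip.
have -> : n%:R * expect (prod_measure pi) f =
    \sum_(i < n) expect (prod_measure pi) (avg pi i f).
  under eq_bigr do rewrite expect_avg//.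
  by rewrite sumr_const card_ord mulr_natl.
rewrite /prod_dirichlet_ln /expect !pair_bigA/=.
(* Entropy and Dirichlet form of the restrictions of [f] to lines are compared
   by the one-dimensional inequality, for each pair [(i, x)]. *)
apply: concave_perspective_sum => //= -[i x]/=.
have mu0 : 0 <= prod_measure pi x by case: mup.
have D0 : 0 <= site_dirichlet L pi f i x by exact: dirichlet_ln_ge0.
have E0 : 0 < avg pi i f x by exact: expect_gt0.
split; first by rewrite mulr_ge0// ltW.
- by rewrite mulr_ge0.
- by move=> /eqP; rewrite mulf_eq0 (gt_eqF E0) orbF => /eqP ->; rewrite mul0r.
have [->|mun] := eqVneq (prod_measure pi x) 0; first by rewrite !mul0r.
rewrite -mulrA ler_wpM2l// -ler_pdivrMl// mulrC.
rewrite [X in Phi X](_ : _ = site_dirichlet L pi f i x / avg pi i f x).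
  exact: lsi.
by field; rewrite mun gt_eqF.
Qed.

(** * The product semigroup *)

Lemma is_derive_prodr (R : realType) (I : finType) (F : I -> R -> R)
    (dF : I -> R) (t : R) :
  (forall i, is_derive t 1 (F i) (dF i)) ->
  is_derive t 1 (fun s => \prod_i F i s)
    (\sum_i dF i * \prod_(j | j != i) F j t).
Proof.
move=> Fd.
(* Stated over a duplicate-free sequence, Leibniz's rule admits an induction:
   only then do the products over [j != i] have the expected factors. *)
suff seqd (r : seq I) : uniq r -> is_derive t 1 (fun s => \prod_(i <- r) F i s)
    (\sum_(i <- r) dF i * \prod_(j <- r | j != i) F j t).
  have := seqd (index_enum I) (index_enum_uniq I); exact.
elim: r => [_|i r IH /= /andP[ir ur]].
  under eq_fun do rewrite big_nil.
  by rewrite big_nil; exact: is_derive_cst.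
under eq_fun do rewrite big_cons.
apply: (is_derive_eq (is_derive_mulr (Fd i) (IH ur))).
rewrite big_cons big_cons eqxx/=; congr (_ + _).
  congr (_ * _); rewrite big_seq [RHS]big_seq_cond; apply: eq_bigl => j.
  by rewrite andb_idr// => jr; apply: contraNneq ir => <-.
rewrite mulr_sumr big_seq [RHS]big_seq; apply: eq_bigr => k kr.
rewrite big_cons ifT; last by apply: contraNneq ir => ->.
by rewrite mulrCA.
Qed.

Definition flow (R : realType) (X : finType) (n : nat) (L : X -> X -> R)
    (f : {ffun 'I_n -> X} -> R) (t : R) : {ffun 'I_n -> X} -> R :=
  kact (tensor_kernel (semigroup L t)) f.

(** Leibniz's rule gives one term for each coordinate, and in the [i]-th term
    the backward equation for the factor [i] can be pulled out of the
    product. *)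
Lemma is_derive_flow (R : realType) (X : finType) (n : nat) (L : X -> X -> R)
    (f : {ffun 'I_n -> X} -> R) (t : R) x :
  is_derive t 1 (fun s => flow L f s x) (\sum_i site_gen L i (flow L f t) x).
Proof.
rewrite /flow /kact /tensor_kernel.
have Kd (y : {ffun 'I_n -> X}) := is_derive_prodr
  (fun i : 'I_n => is_derive_semigroup L t (x i) (y i)).
under eq_fun do under eq_bigr do rewrite mulrC.
apply: (is_derive_eq (is_derive_sumr (fun y => is_derive_mulrl (f y) (Kd y)))).
under eq_bigr do rewrite mulr_sumr.
rewrite exchange_big; apply: eq_bigr => i _; rewrite /site_gen.
under eq_bigr do rewrite mulr_suml mulr_sumr.
rewrite exchange_big; apply: eq_bigr => z _.
rewrite mulr_sumr; apply: eq_bigr => y _.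
rewrite [in RHS](bigD1 i)//= upd_same.
rewrite [in RHS](eq_bigr (fun j => semigroup L t (x j) (y j))); first by ring.
by move=> j /negbTE ji; rewrite ffunE ji.
Qed.

Lemma flow0 (R : realType) (X : finType) (n : nat) (L : X -> X -> R)
    (f : {ffun 'I_n -> X} -> R) x : flow L f 0 x = f x.
Proof.
rewrite /flow /kact (bigD1 x)//= [X in _ + X]big1 => [|y yx].
  rewrite addr0 /tensor_kernel big1 ?mul1r// => i _.
  by rewrite semigroup0 eqxx.
have /existsP[i xyi] : [exists i, x i != y i].
  apply: contraNT yx; rewrite negb_exists => /forallP xy.
  by apply/eqP/ffunP => i; apply/esym/eqP; have := xy i; rewrite negbK.
rewrite /tensor_kernel (bigD1 i)//= semigroup0 (negbTE xyi) !mul0r//.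
Qed.

Lemma is_prob_tensor_semigroup (R : realType) (X : finType) (n : nat)
    (L : X -> X -> R) (t : R) (x : {ffun 'I_n -> X}) :
  generator L -> 0 <= t -> is_prob (tensor_kernel (semigroup L t) x).
Proof.
move=> hL t0; split=> [y|].
  by apply: prodr_ge0 => i _; exact: semigroup_ge0.
rewrite /tensor_kernel -(bigA_distr_bigA (fun i z => semigroup L t (x i) z)).
by rewrite big1// => i _; exact: semigroup_sum1.
Qed.

Lemma flow_shift (R : realType) (X : finType) (n : nat) (L : X -> X -> R)
    (f : {ffun 'I_n -> X} -> R) (e t : R) x :
  generator L -> 0 <= t -> flow L (fun y => f y + e) t x = flow L f t x + e.
Proof.
move=> hL t0; rewrite /flow /kact.
rewrite -[LHS]/(expect _ (fun y => f y + e)) expectD expect_cst//.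
exact: is_prob_tensor_semigroup.
Qed.

Lemma expect_flow (R : realType) (X : finType) (n : nat) (L : X -> X -> R)
    (pi : X -> R) (f : {ffun 'I_n -> X} -> R) (t : R) :
  is_prob pi -> stationary L pi ->
  expect (prod_measure pi) (flow L f t) = expect (prod_measure pi) f.
Proof.
move=> pip st; have <- : expect (prod_measure pi) (flow L f 0) =
    expect (prod_measure pi) f by apply: eq_expect => x; rewrite flow0.
apply: (@is_derive_0_is_cst _
  (fun s => expect (prod_measure pi) (flow L f s))) => s.
apply: is_derive_eq.
  apply: is_derive_sumr => x; apply: is_derive_mulrl; exact: is_derive_flow.
under eq_bigr do rewrite mulr_sumr.
by rewrite exchange_big big1// => i _; exact: expect_site_gen.
Qed.

(** The derivative of [u ln u] is [u' ln u + u'], and the last term has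
    expectation 0 by stationarity. *)
Lemma is_derive_Ent_flow (R : realType) (X : finType) (n : nat)
    (L : X -> X -> R) (pi : X -> R) (f : {ffun 'I_n -> X} -> R) (t : R) :
  is_prob pi -> stationary L pi ->
  (forall x, 0 < flow L f t x) ->
  is_derive t 1
    (fun s => expect (prod_measure pi)
       (fun x => flow L f s x * ln (flow L f s x)))
    (- prod_dirichlet_ln L pi (flow L f t)).
Proof.
move=> pip st u0; set u := flow L f t in u0 *.
have phid x : is_derive t 1 (fun s => flow L f s x * ln (flow L f s x))
    ((\sum_i site_gen L i u x) * ln (u x) + \sum_i site_gen L i u x).
  have ud := is_derive_flow L f t x.
  have lnd := is_derive1_comp (is_derive1_ln (u0 x)) ud.
  apply: (is_derive_eq (is_derive_mulr ud lnd)); congr (_ + _).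
  by rewrite -/u mulrA divff ?mul1r// gt_eqF.
apply: (is_derive_eq (is_derive_sumr (fun x =>
  is_derive_mulrl (prod_measure pi x) (phid x)))).
rewrite /prod_dirichlet_ln -sumrN.
transitivity (\sum_i (
    expect (prod_measure pi) (fun x => site_gen L i u x * ln (u x)) +
    expect (prod_measure pi) (site_gen L i u))).
  rewrite big_split/= /expect exchange_big/= [X in _ = _ + X]exchange_big/=.
  rewrite -big_split; apply: eq_bigr => x _.
  by rewrite mulrDr mulr_suml !mulr_sumr.
apply: eq_bigr => i _.
by rewrite expect_site_gen// addr0 expect_site_dirichlet// opprK.
Qed.

(** * Comparison with a scalar differential equation *)

(** Clearing the denominator turns the relative derivative into an estimate that
    also holds at [s = t], which is convenient for continuity and for two-sided
    derivatives. *)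
Lemma has_derivative_in_near (R : realType) (I : set R) (r : R -> R)
    (t d e : R) :
  has_derivative_in I r t d -> 0 < e ->
  \forall s \near t, I s -> `|r s - r t - d * (s - t)| <= e * `|s - t|.
Proof.
move=> /cvgrPdist_le rd e0; have : \forall s \near t, s != t -> I s ->
    `|d - (r s - r t) / (s - t)| <= e by exact: rd e e0.
apply: filterS => s hs Is.
have [->|st] := eqVneq s t; first by rewrite !subrr mulr0 subr0 !normr0 mulr0.
have -> : r s - r t - d * (s - t) = - ((d - (r s - r t) / (s - t)) * (s - t)).
  by field; rewrite subr_eq0.
by rewrite normrN normrM ler_wpM2r ?hs.
Qed.

Lemma has_derivative_in_cvg (R : realType) (I : set R) (r : R -> R) (t d : R) :
  has_derivative_in I r t d -> r s @[s --> within I (nbhs t)] --> r t.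
Proof.
move=> rd; apply/cvgrPdist_le => e e0.
have c0 : 0 < `|d| + 1 by rewrite ltr_wpDl.
suff : \forall s \near t, I s -> `|r t - r s| <= e by exact.
near=> s => Is.
have h : `|r s - r t - d * (s - t)| <= 1 * `|s - t|.
  by move: Is; near: s; exact: has_derivative_in_near rd ltr01.
have st : `|t - s| <= e / (`|d| + 1).
  by near: s; apply: cvgr_dist_le; [exact: cvg_id|exact: divr_gt0].
rewrite distrC; have -> : r s - r t = (r s - r t - d * (s - t)) + d * (s - t).
  by rewrite subrK.
apply: le_trans (ler_normD _ _) _; rewrite normrM.
move: st; rewrite ler_pdivlMr// distrC => st.
by move: h st; lra.
Unshelve. all: by end_near. Qed.

Lemma has_derivative_in_interior (R : realType) (I : set R) (r : R -> R)
    (t d : R) :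
  has_derivative_in I r t d -> nbhs t I -> is_derive t 1 r d.
Proof.
move=> rd nI.
have lim : h^-1 *: (r (h *: 1 + t) - r t) @[h --> 0^'] --> d.
  apply/cvgrPdist_le => e e0.
  have : \forall s \near t, `|r s - r t - d * (s - t)| <= e * `|s - t|.
    near=> s; have Is : I s by near: s.
    by move: Is; near: s; exact: has_derivative_in_near rd e0.
  move=> /nbhs_ballP[/= del del0 hdel].
  suff : \forall h \near (0 : R), h != 0 ->
      `|d - h^-1 *: (r (h *: 1 + t) - r t)| <= e by exact.
  near=> h => h0.
  have := hdel (h *: 1 + t); rewrite [_ *: _]mulr1 addrK /ball/=.
  have -> : t - (h + t) = - h by rewrite opprD addrCA subrr addr0.
  have hdl : `|h| < del by near: h; exact: (@nbhs0_lt R R^o).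
  rewrite normrN => /(_ hdl).
  have -> : d - h^-1 *: (r (h + t) - r t) = - (h^-1 * (r (h + t) - r t - d * h)).
    change (d - h^-1 * (r (h + t) - r t) =
      - (h^-1 * (r (h + t) - r t - d * h))).
    by field.
  rewrite normrN normrM normfV => hh.
  by rewrite ler_pdivrMl ?normr_gt0// [leRHS]mulrC.
by apply: DeriveDef; [exact: cvgP lim|exact: cvg_lim].
Unshelve. all: by end_near. Qed.

(** If [G T > 0], let [c] be the last point of [0, T] where [G <= 0]. Beyond [c]
    the function is positive, hence nonincreasing by the mean value theorem, so
    [G T <= G c <= 0]. *)
Lemma nonpos_of_derive_where_pos (R : realType) (G dG : R -> R) (T : R) :
  0 <= T -> {within `[0, T], continuous G} ->
  (forall x, 0 < x -> x <= T -> is_derive x 1 G (dG x)) ->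
  (forall x, 0 < x -> x <= T -> 0 < G x -> dG x <= 0) ->
  G 0 <= 0 -> G T <= 0.
Proof.
move=> T0 Gc Gd dG0 G00; rewrite leNgt; apply/negP => GT.
pose A := [set s | [/\ 0 <= s, s <= T & G s <= 0]].
have A0 : A 0 by split.
have supA : has_sup A by split; [exists 0|exists T => s []].
pose c := sup A.
have c0 : 0 <= c by exact: sup_upper_bound.
have cT : c <= T by apply: ge_sup; [exists 0|move=> s []].
have Gpos s : c < s -> s <= T -> 0 < G s.
  move=> cs sT; rewrite ltNge; apply/negP => Gs.
  have : s <= c.
    by apply: sup_upper_bound => //; split=> //; exact: le_trans (ltW cs).
  by rewrite leNgt cs.
have Gc0 : G c <= 0.
  rewrite leNgt; apply/negP => Gcp.
  have cp : 0 < c.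
    by rewrite lt_neqAle c0 andbT; apply: contraTneq Gcp => <-; rewrite -leNgt.
  have : \forall s \near c, 0 < G s.
    have [dc _] := Gd c cp cT.
    have /derivable1_diffP/differentiable_continuous cc := dc.
    exact: (cvgr_gt (G c) cc).
  move=> /nbhs_ballP[/= e e0 he].
  have [s [s0 sT Gs] cs] := sup_adherent e0 supA.
  have : 0 < G s.
    apply: he; rewrite /ball/= ger0_norm; first by rewrite ltrBlDr -ltrBlDl.
    by rewrite subr_ge0; apply: sup_upper_bound => //; split.
  by rewrite ltNge Gs.
have ltcT : c < T.
  by rewrite lt_neqAle cT andbT; apply: contraTneq GT => <-; rewrite -leNgt.
have [x xcT|//|y] := @MVT _ G dG c T ltcT.
- move: xcT; rewrite in_itv/= => /andP[cx xT].
  by apply: Gd; [exact: le_lt_trans cx|exact: ltW].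
- apply: continuous_subspaceW Gc => x/=; rewrite !in_itv/= => /andP[cx ->].
  by rewrite (le_trans c0).
rewrite in_itv/= => /andP[cy yT] GTc.
have : dG y * (T - c) <= 0.
  rewrite mulr_le0_ge0 ?subr_ge0 ?(ltW ltcT)//.
  apply: dG0; [exact: le_lt_trans cy|exact: ltW|].
  by apply: Gpos; last exact: ltW.
by rewrite -GTc; move: GT Gc0; lra.
Qed.

(** [F - rho] is nonincreasing wherever it is positive, which is all that
    [nonpos_of_derive_where_pos] asks for. *)
Lemma le_C1_solution (R : realType) (D : set R) (b F dF rho : R -> R)
    (t0 : \bar R) (t : R) :
  C1_solution [set s : R | 0 <= s /\ (s%:E < t0)%E] D b rho ->
  (forall s : R, 0 <= s -> is_derive s 1 F (dF s)) ->
  (forall s, 0 <= s -> (s%:E < t0)%E -> rho s < F s -> dF s <= - b (rho s)) ->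
  F 0 <= rho 0 -> 0 <= t -> (t%:E < t0)%E -> F t <= rho t.
Proof.
move=> [_ rhod _] Fd dFle F0 tge0 tt0.
have It (s : R) : 0 <= s -> s <= t -> 0 <= s /\ (s%:E < t0)%E.
  by move=> s0 st; split=> //; apply: le_lt_trans tt0; rewrite lee_fin.
rewrite -subr_le0.
apply: (@nonpos_of_derive_where_pos _ (fun s => F s - rho s)
  (fun s => dF s - - b (rho s))) => //.
- have Fc : {within `[0, t], continuous F}.
    by apply: derivable_within_continuous => s; rewrite in_itv/= => /andP[/Fd[]].
  have rc : {within `[0, t], continuous rho}.
    apply/subspace_continuousP => s/=; rewrite in_itv/= => /andP[s0 st].
    apply: cvg_trans (has_derivative_in_cvg (rhod s (It s s0 st))).
    apply: cvg_app; apply: within_subset => r/=.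
    by rewrite in_itv/= => /andP[]; exact: It.
  by move=> s; apply: cvgB; [exact: Fc|exact: rc].
- move=> s s0 st; have [s0' st0] := It s (ltW s0) st.
  apply: is_deriveB; first exact: Fd.
  apply: has_derivative_in_interior (rhod s _) _; first by split.
  case: t0 st0 {tt0 It rhod dFle} => [r| |]// st0.
    near=> u; split; near: u; first exact: lt_le_nbhsr.
    by near=> u; rewrite lte_fin; near: u; apply: lt_nbhsl; rewrite -lte_fin.
  by near=> u; split; [near: u; exact: lt_le_nbhsr|exact: ltry].
- move=> s s0 st; have [_ st0] := It s (ltW s0) st.
  by rewrite subr_gt0 subr_le0 => Fs; apply: dFle => //; exact: ltW.
- by rewrite subr_le0.
Unshelve. all: by end_near. Qed.

(** * Decay of entropy *)

(** The inverse of [Phi] can be applied to [v] only when [v] is in the range of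
    [Phi]; the intermediate value theorem provides this, together with the bound
    [c <= d] on the value of the inverse. *)
Lemma LSI_function_attains (R : realType) (Phi : R -> R) (v d : R) :
  LSI_function Phi -> 0 <= d -> 0 <= v -> v <= Phi d ->
  exists c, [/\ 0 <= c, c <= d & Phi c = v].
Proof.
move=> [_ _ Phic Phi0] d0 v0 vd.
have Phicd : {within `[0, d], continuous Phi}.
  by apply: continuous_subspaceW Phic => x/=; rewrite !in_itv/= => /andP[->].
have [|c +] := IVT d0 Phicd (v := v).
  by rewrite Phi0 min_l ?max_r ?v0// (le_trans v0).
by rewrite in_itv/= => /andP[c0 cd] <-; exists c.
Qed.

(** For positive [f] the evolved function stays positive, so its entropy per
    coordinate [F] is differentiable, and [LSI1_prod] makes it a subsolution of
    the differential equation for [rho]. *)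
Lemma Ent_flow_le_of_pos (R : realType) (X : finType) (L : X -> X -> R)
    (pi : X -> R) (Phi b rho : R -> R) (t0 : \bar R) (n : nat)
    (f : {ffun 'I_n -> X} -> R) (t : R) :
  generator L -> is_prob pi -> stationary L pi -> LSI1 L pi Phi ->
  convex_increasing_inverse Phi b ->
  C1_solution [set s : R | 0 <= s /\ (s%:E < t0)%E] (range_nneg Phi) b rho ->
  (1 <= n)%N -> (forall x, 0 < f x) ->
  Ent (prod_measure pi) f <= n%:R * rho 0 * expect (prod_measure pi) f ->
  0 <= t -> (t%:E < t0)%E ->
  Ent (prod_measure pi) (flow L f t) <=
    n%:R * rho t * expect (prod_measure pi) f.
Proof.
move=> hL pip st lsi [bK _ _ bmono] rhos n1 f0 Ef0 tge0 tt0.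
have mup := @is_prob_prod_measure R X n pi pip.
have u0 s x : 0 <= s -> 0 < flow L f s x.
  by move=> s0; exact: expect_gt0 (is_prob_tensor_semigroup x hL s0) f0.
set a := expect (prod_measure pi) f.
have a0 : 0 < a by exact: expect_gt0.
pose N := n%:R * a.
have N0 : 0 < N by rewrite mulr_gt0// ltr0n.
pose F s := N^-1 * (expect (prod_measure pi)
  (fun x => flow L f s x * ln (flow L f s x)) - a * ln a).
pose D s := prod_dirichlet_ln L pi (flow L f s).
have FE s : 0 <= s -> F s = N^-1 * Ent (prod_measure pi) (flow L f s).
  move=> s0; rewrite EntE ?expect_flow// => x; exact/ltW/u0.
have Fd (s : R) : 0 <= s -> is_derive s 1 F (N^-1 * - D s).
  move=> s0; apply: is_derive_mulrl.
  have := is_deriveB (is_derive_Ent_flow pip st (fun x => u0 s x s0))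
    (is_derive_cst (a * ln a) s 1).
  by rewrite subr0.
suff : F t <= rho t.
  by rewrite FE// ler_pdivrMl// /N mulrAC.
apply: (le_C1_solution (b := b) rhos Fd) => //; last first.
  rewrite FE// ler_pdivrMl// /N mulrAC; apply: le_trans Ef0.
  rewrite le_eqVlt; apply/orP; left; apply/eqP; congr Ent.
  by apply/funext => x; rewrite flow0.
move=> s s0 st0 rhoF.
have D0 : 0 <= D s.
  apply: sumr_ge0 => i _; apply: sumr_ge0 => x _.
  rewrite mulr_ge0//; first by case: mup.
  by apply: dirichlet_ln_ge0 => // z; exact: u0.
have Fge0 : 0 <= F s.
  by rewrite FE// mulr_ge0 ?invr_ge0 ?(ltW N0)// Ent_ge0// => x; exact: u0.
have FPhi : F s <= Phi (D s / N).
  rewrite FE// ler_pdivrMl//.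
  have := LSI1_prod hL pip st lsi (fun x => u0 s x s0).
  by rewrite expect_flow.
have hPhi : LSI_function Phi by case: lsi.
have [c [c0 cD cF]] :=
  LSI_function_attains hPhi (divr_ge0 D0 (ltW N0)) Fge0 FPhi.
have rc : c \in (`[0, +oo[%classic : set R) by rewrite inE/= in_itv/= c0.
have brho : b (rho s) < b (F s).
  apply: bmono => //; rewrite inE.
    by case: rhos => rhoD _ _; apply: rhoD; split.
  by exists c => //; rewrite inE in rc.
rewrite -cF bK// in brho; rewrite mulrN lerN2 mulrC.
by apply: le_trans cD; exact: ltW.
Qed.

Lemma le0_of_forall_leM (R : realType) (x C : R) :
  0 < C -> (forall d, 0 < d -> d <= 1 -> x <= C * d) -> x <= 0.
Proof.
move=> C0 h; rewrite leNgt; apply/negP => x0.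
have xC0 : 0 < x + C by rewrite addr_gt0.
(* This choice of [d] lies in ]0, 1] and makes [C * d < x]. *)
have := h (x / (x + C)); rewrite divr_gt0// ler_pdivrMr// mul1r lerDl (ltW C0).
move=> /(_ isT isT); rewrite mulrA ler_pdivlMr//; nra.
Qed.

Theorem theorem2 (R : realType) (X : finType) (L : X -> X -> R) (pi : X -> R)
    (Phi1 b1 : R -> R) (rho : R -> R) (t0 : \bar R)
    (hL : generator L) (hpi : is_prob pi) (hstat : stationary L pi)
    (hLSI : LSI1 L pi Phi1)
    (hb1 : convex_increasing_inverse Phi1 b1)
    (ht0 : (0 < t0)%E)
    (hrho : C1_solution [set t : R | 0 <= t /\ (t%:E < t0)%E]
              (range_nneg Phi1) b1 rho)
    (hrho0 : 0 < rho 0)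
    (n : nat) (hn : (1 <= n)%N) (f : {ffun 'I_n -> X} -> R)
    (hf : forall x, 0 <= f x)
    (hEf : 0 < expect (prod_measure pi) f)
    (hEnt : n%:R^-1 * (Ent (prod_measure pi) f / expect (prod_measure pi) f)
            <= rho 0)
    (t : R) (ht : 0 <= t) (htt0 : (t%:E < t0)%E) :
  Ent (prod_measure pi) (kact (tensor_kernel (semigroup L t)) f)
  <= n%:R * rho t * expect (prod_measure pi) f.
Proof.
have mup := @is_prob_prod_measure R X n pi hpi.
rewrite -/(flow L f t); set a := expect (prod_measure pi) f in hEf hEnt *.
have n0 : 0 < n%:R :> R by rewrite ltr0n.
have Ent0 : Ent (prod_measure pi) f <= n%:R * rho 0 * a.
  by move: hEnt; rewrite ler_pdivrMl// ler_pdivrMr.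
have u0 x : 0 <= flow L f t x.
  apply: sumr_ge0 => y _; rewrite mulr_ge0//.
  by case: (is_prob_tensor_semigroup x hL ht).
have Eu : expect (prod_measure pi) (flow L f t) = a by exact: expect_flow.
rewrite -subr_le0; apply: (@le0_of_forall_leM _ _ (`|n%:R * rho t| + 4 + a)).
  by rewrite ltr_wpDl// addr_ge0.
(* The perturbation is [d ^+ 2] so that [- d^2 ln (d^2) = - 2 d^2 ln d] is at
   most [2 d], by the tangent inequality [- d ln d <= 1 - d]. *)
move=> d d0 d1; have e0 : 0 < d ^+ 2 by rewrite exprn_gt0.
have ed : d ^+ 2 <= d by rewrite expr2 ler_piMr// ltW.
have ae0 : 0 < a + d ^+ 2 by rewrite addr_gt0.
have fe0 x : 0 < f x + d ^+ 2 by rewrite ltr_wpDl.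
have Efe : expect (prod_measure pi) (fun x => f x + d ^+ 2) = a + d ^+ 2.
  by rewrite expectD expect_cst.
have Ent_e : Ent (prod_measure pi) (fun x => f x + d ^+ 2) <=
    n%:R * rho 0 * expect (prod_measure pi) (fun x => f x + d ^+ 2).
  apply: le_trans (Ent_shift_le mup hf hEf e0) _; apply: le_trans Ent0 _.
  by rewrite Efe ler_wpM2l ?lerDl ?mulr_ge0 ?ltW.
have := Ent_flow_le_of_pos hL hpi hstat hLSI hb1 hrho hn fe0 Ent_e ht htt0.
have -> : flow L (fun x => f x + d ^+ 2) t = (fun x => flow L f t x + d ^+ 2).
  by apply/funext => x; exact: flow_shift.
rewrite Efe => Ent_ue.
have := Ent_le_shift mup u0 (_ : 0 < expect _ (flow L f t)) e0.
rewrite Eu => /(_ hEf) Ent_u.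
have lnd : - (d ^+ 2 * ln (d ^+ 2)) <= 2 * d.
  have := mulr_ln_le (ltW d0) ltr01; rewrite ln1 lnXn// expr2; nra.
have lna : d ^+ 2 * (1 + ln (a + d ^+ 2)) <= d * (2 + a).
  have := ln_sublinear ae0; nra.
have nrho : n%:R * rho t * d ^+ 2 <= `|n%:R * rho t| * d.
  by apply: le_trans (ler_wpM2l _ ed) => //; rewrite ler_wpM2r ?ler_norm// ltW.
by move: Ent_ue Ent_u; lra.
Qed.
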